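(* Let $n$ be a positive integer, let $D\subsetneq\mathbb{R}^n$ be a domain with $\operatorname{diam}D<\infty$, and let $r=\sqrt{n/(2n+2)}\,\operatorname{diam}D$. Then $$\tilde{\tau}_D(x,y)\ge\log\left(1+\frac{2|x-y|}{\sqrt{4r^2-|x-y|^2}}\right)\ge c\,\frac{|x-y|}{r}$$ for all distinct $x,y\in D$, with equality in the first step when $D=B^n(z,r)$ and $z=(x+y)/2$. Here $$c=\frac{1}{t_0}\log\left(1+\frac{2t_0}{\sqrt{4-t_0^2}}\right)=\min_{0<t<2}\frac1t\log\left(1+\frac{2t}{\sqrt{4-t^2}}\right)\quad(c\approx 0.76),$$ where $t_0\in(0,2)$ ($t_0\approx1.16$) is the solution in $(0,2)$ of the equation $$(4-t^2)\left(2t+\sqrt{4-t^2}\right)\log\left(1+\frac{2t}{\sqrt{4-t^2}}\right)-8t=0.$$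
   Context: $|\cdot|$ is the Euclidean norm on $\mathbb{R}^n$, $B^n(z,r)=\{x\in\mathbb{R}^n:|x-z|<r\}$, and $\operatorname{diam}$ is the Euclidean diameter. A domain is a nonempty open connected set. The scale invariant Cassinian metric of a domain $D\subsetneq\mathbb{R}^n$ is $$\tilde{\tau}_D(x,y)=\log\left(1+\sup_{p\in\partial D}\frac{|x-y|}{\sqrt{|x-p||p-y|}}\right),\quad x,y\in D.$$ *)

(* Defs.v *)
From HB Require Import structures.
From mathcomp Require Import all_boot all_order all_algebra.
From mathcomp Require Import all_classical all_reals all_analysis.

Set Implicit Arguments.
Unset Strict Implicit.
Unset Printing Implicit Defensive.

Import Order.TTheory GRing.Theory Num.Theory.
Import numFieldNormedType.Exports.

Local Open Scope classical_set_scope.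
Local Open Scope ring_scope.

(* The library's norm on 'rV[R]_n is the sup norm.  It induces the Euclidean
   topology, so the library's open, connected, closure and interior are used
   as they are, but distances, balls and diameters need the norm below. *)
Definition enorm (R : realType) (n : nat) (x : 'rV[R]_n) : R :=
  Num.sqrt (\sum_(i < n) x 0 i ^+ 2).

Definition eball (R : realType) (n : nat) (z : 'rV[R]_n) (r : R)
    : set 'rV[R]_n :=
  [set x | enorm (x - z) < r].

Definition ediam (R : realType) (n : nat) (D : set 'rV[R]_n) : \bar R :=
  ereal_sup [set d | exists x y, [/\ D x, D y & d = (enorm (x - y))%:E]].

Definition domain (R : realType) (n : nat) (D : set 'rV[R]_n) : Prop :=
  [/\ D !=set0, open D & connected D].

Definition boundary (T : topologicalType) (D : set T) : set T :=
  closure D `\` interior D.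

(* [sup] is 0 on empty or unbounded sets.  Neither occurs when D is a proper
   subdomain and x, y are in D: the boundary is nonempty and keeps a positive
   distance from x and y. *)
Definition cassinian (R : realType) (n : nat) (D : set 'rV[R]_n)
    (x y : 'rV[R]_n) : R :=
  ln (1 + sup [set enorm (x - y) / Num.sqrt (enorm (x - p) * enorm (p - y))
              | p in boundary D]).

Definition is_minimum (R : realType) (E : set R) (m : R) : Prop :=
  E m /\ lbound E m.

(* Main.v *)
Require Import Defs.
From HB Require Import structures.
From mathcomp Require Import all_boot all_order all_algebra.
From mathcomp Require Import all_classical all_reals all_analysis.
From mathcomp Require Import ring lra.

Set Implicit Arguments.
Unset Strict Implicit.
Unset Printing Implicit Defensive.

Import Order.TTheory GRing.Theory Num.Theory.
Import numFieldNormedType.Exports.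

Local Open Scope classical_set_scope.
Local Open Scope ring_scope.

(** The line through x and y leaves the bounded open set D beyond x and beyond y,
    at boundary points p and q with |p - q| <= diam D <= 2 r. The one closer to
    the midpoint m of x and y, say p, is at distance at most r from m, and since
    p, x and y are collinear,
    [|x - p| |p - y| = |p - m|^2 - (|x - y| / 2)^2 <= r^2 - (|x - y| / 2)^2].
    Inserting p in the supremum gives the first inequality ([cassinian_ge]). In
    a ball centred at m, Cauchy-Schwarz gives the reverse estimate at every
    boundary point ([cassinian_eball_le]), hence equality.

    With t = |x - y| / r, the second inequality says that the slope L(t) / t of
    L(t) = log (1 + 2 t / sqrt (4 - t^2)) is minimal at t0. The derivative of
    this slope is - h(t) / t^2, where h(t) = L(t) - t L'(t) is the intercept of
    the tangent at t, and the equation for t0 says h(t0) = 0. Now L' = 8 / q with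
    q(t) = (4 - t^2) (2 t + sqrt (4 - t^2)), so h' = 8 t q' / q^2 has the sign of
    q', which goes from plus to minus. As h(0) = 0, the intercept h first
    increases from 0 and then decreases, so it has at most one zero in (0, 2),
    where it passes from positive to negative ([tangent_intercept_sign]). That
    zero exists and is located by rational bounds of L at 1.155 and 1.165, which
    also give the numerical value of the minimum. *)

(** * Monotonicity, derivatives and bounds of ln and exp *)

Section Calculus.
Variable R : realType.
Implicit Types s t x a b : R.

Lemma derive_gt0_lt (f df : R -> R) a b : a < b ->
  (forall t, a <= t <= b -> is_derive t 1 f (df t)) ->
  (forall t, a < t < b -> 0 < df t) -> f a < f b.
Proof.
move=> ab fdf df0.
have [|| c] := MVT (f := f) (df := df) ab.
- by move=> t; rewrite in_itv /= => /andP[at_ tb]; apply: fdf; rewrite !ltW.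
- apply: derivable_within_continuous => t; rewrite in_itv /= => tab.
  by case: (fdf t tab).
rewrite in_itv /= => cab E; rewrite -subr_gt0 E mulr_gt0 ?subr_gt0//.
exact: df0.
Qed.

Lemma is_derive_scale a t : is_derive t 1 (fun t => a * t : R) a.
Proof.
have := is_deriveM (is_derive_cst (a : R) t (1 : R)) (is_derive_id t (1 : R)).
by move=> /is_derive_eq; apply; rewrite /= /cst /GRing.scale /=; ring.
Qed.

Lemma is_derive_quot (f g : R -> R) t df dg : g t != 0 ->
  is_derive t 1 f df -> is_derive t 1 g dg ->
  is_derive t 1 (fun t => f t / g t) ((g t * df - f t * dg) / g t ^+ 2).
Proof.
move=> g0 ff gg.
have := is_deriveM (f := f) (g := fun t => (g t)^-1) ff (is_deriveV g0 gg).
by move=> /is_derive_eq; apply; rewrite /GRing.scale /=; field.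
Qed.

(** The logarithm here is twice the inverse hyperbolic tangent of s, whose power
    series has nonnegative terms; the derivative of the difference of the two
    sides is the remainder 2 s^6 / (1 - s^2) of a geometric series. *)
Lemma ln_ge_atanh s : 0 < s < 1 ->
  2 * (s + s ^+ 3 / 3 + s ^+ 5 / 5) <= ln ((1 + s) / (1 - s)).
Proof.
move=> s01; rewrite ln_div ?posrE; try lra.
pose f (x : R) := ln (1 + x) - ln (1 - x) - 2 * (x + x ^+ 3 / 3 + x ^+ 5 / 5).
have f0 : f 0 = 0 by rewrite /f addr0 subr0 ln1 !expr0n /=; lra.
suff : f 0 < f s by rewrite f0 /f; lra.
apply: (derive_gt0_lt (df := fun x => 2 * x ^+ 6 / (1 - x ^+ 2))); first lra.
  move=> x x0.
  have dp : is_derive x 1 (fun x => ln (1 + x)) (1 + x)^-1.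
    have d1 := is_deriveD (is_derive_cst (1 : R) x (1 : R))
      (is_derive_id x (1 : R)).
    have x1 : 0 < 1 + x by lra.
    have := is_derive1_comp (f := @ln R) (g := fun x => 1 + x)
      (is_derive1_ln x1) d1.
    by move=> /is_derive_eq; apply; rewrite add0r mulr1.
  have dm : is_derive x 1 (fun x => ln (1 - x)) (- (1 - x)^-1).
    have d1 := is_deriveB (is_derive_cst (1 : R) x (1 : R))
      (is_derive_id x (1 : R)).
    have x1 : 0 < 1 - x by lra.
    have := is_derive1_comp (f := @ln R) (g := fun x => 1 - x)
      (is_derive1_ln x1) d1.
    by move=> /is_derive_eq; apply; rewrite sub0r mulrN1.
  (* As a polynomial, the truncated series is differentiated by rewriting. *)
  pose p : {poly R} := 2 *: ('X + 3^-1 *: 'X^3 + 5^-1 *: 'X^5).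
  have dp' := is_derive_poly p x.
  have := is_deriveB (is_deriveB dp dm) dp'.
  have -> : (fun x => ln (1 + x)) - (fun x => ln (1 - x)) - horner p = f.
    apply/funext => y; rewrite /f /p !fctE.
    by rewrite !(hornerD, hornerZ, hornerX, hornerXn); lra.
  move=> /is_derive_eq; apply.
  rewrite /p !(derivZ, derivD, derivXn, derivX).
  rewrite !(hornerD, hornerZ, hornerMn, hornerC, hornerXn) /=.
  by field; rewrite !gt_eqF//; nra.
move=> x x0; rewrite divr_gt0 ?pmulr_rgt0 ?exprn_gt0//; nra.
Qed.

Lemma expR_ge_series x n : 0 <= x -> series (exp_coeff x) n <= expR x.
Proof.
move=> x0; apply: nondecreasing_cvgn_le; last exact: is_cvg_series_exp_coeff.
apply/nondecreasing_seqP => k; rewrite /series /= big_nat_recr//= lerDl.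
exact: exp_coeff_ge0.
Qed.

End Calculus.

(** * The function log (1 + 2 t / sqrt (4 - t^2)) and its slope *)

Section LogBound.
Variable R : realType.
Implicit Types t a b : R.

(** In a circle of diameter 2, [t] and [cochord t] are the legs of a right
    triangle on a diameter. *)
Definition cochord t : R := Num.sqrt (4 - t ^+ 2).
Definition logbound t : R := ln (1 + 2 * t / cochord t).
(** The derivative of [logbound] is [8 / slope_den t]. *)
Definition slope_den t : R := (4 - t ^+ 2) * (2 * t + cochord t).
(** The derivative of [slope_den]. *)
Definition slope_den' t : R := 8 - 6 * t ^+ 2 - 3 * t * cochord t.
(** The height at which the tangent to the graph of [logbound] at [t] meets the
    vertical axis. Up to the positive factor [slope_den t] it is the left-hand
    side of the equation for [t0], and up to the factor [- t ^- 2] it is the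
    derivative of [logbound t / t]. *)
Definition tangent_intercept t : R := logbound t - 8 * t / slope_den t.

Lemma cochord_gt0 t : 0 <= t < 2 -> 0 < cochord t.
Proof. by move=> t02; rewrite sqrtr_gt0; nra. Qed.

Lemma sqr_cochord t : 0 <= t < 2 -> cochord t ^+ 2 = 4 - t ^+ 2.
Proof. by move=> t02; rewrite sqr_sqrtr//; nra. Qed.

Lemma slope_den_gt0 t : 0 <= t < 2 -> 0 < slope_den t.
Proof. by move=> t02; have w0 := cochord_gt0 t02; rewrite mulr_gt0//; nra. Qed.

Lemma is_derive_sqr_cochord t :
  is_derive t 1 (fun t => 4 - t ^+ 2 : R) (- (2 * t)).
Proof.
have d0 := @is_deriveX R R id 2 t 1 1 (is_derive_id t 1).
have := is_deriveB (is_derive_cst (4 : R) t (1 : R)) d0.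
by move=> /is_derive_eq; apply; rewrite /= /GRing.scale /=; ring.
Qed.

Lemma is_derive_cochord t : 0 <= t < 2 ->
  is_derive t 1 cochord (- t / cochord t).
Proof.
move=> t02; have w0 := cochord_gt0 t02.
have d1 := is_derive_sqr_cochord t.
have d2 : is_derive (4 - t ^+ 2) 1 (@Num.sqrt R) (2 * cochord t)^-1.
  by apply: is_derive1_sqrt; nra.
have := is_derive1_comp (f := @Num.sqrt R) (g := fun t => 4 - t ^+ 2) d2 d1.
by move=> /is_derive_eq; apply; field; rewrite gt_eqF.
Qed.

Lemma is_derive_slope_den t : 0 <= t < 2 ->
  is_derive t 1 slope_den (slope_den' t).
Proof.
move=> t02; have w0 := cochord_gt0 t02; have dw := is_derive_cochord t02.
have d2 : is_derive t 1 (fun t => 2 * t + cochord t) (2 + - t / cochord t).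
  exact: (is_deriveD (f := fun t => 2 * t) (g := cochord)
    (is_derive_scale 2 t) dw).
have := is_deriveM (f := fun t => 4 - t ^+ 2) (is_derive_sqr_cochord t) d2.
move=> /is_derive_eq; apply; rewrite /slope_den' /= /GRing.scale /= -sqr_cochord//.
rewrite [8](_ : _ = 2 * (4 - t ^+ 2) + 2 * t ^+ 2); last by ring.
by rewrite -sqr_cochord//; field; rewrite gt_eqF.
Qed.

Lemma logbound_arg_gt0 t : 0 <= t < 2 -> 0 < 1 + 2 * t / cochord t.
Proof.
move=> t02; have w0 := cochord_gt0 t02.
by rewrite ltr_wpDr// divr_ge0 ?(ltW w0)//; lra.
Qed.

Lemma is_derive_logbound t : 0 <= t < 2 ->
  is_derive t 1 logbound (8 / slope_den t).
Proof.
move=> t02; have w0 := cochord_gt0 t02.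
have dw := is_derive_cochord t02.
have wn0 : cochord t != 0 by rewrite gt_eqF.
have p0 := logbound_arg_gt0 t02.
have d1 : is_derive t 1 (fun t => 1 + 2 * t / cochord t) (8 / cochord t ^+ 3).
  have d0 := is_derive_quot wn0 (is_derive_scale 2 t) dw.
  have := is_deriveD (is_derive_cst (1 : R) t (1 : R)) d0.
  move=> /is_derive_eq; apply; have := sqr_cochord t02 => W.
  have -> : (8 : R) = 2 * cochord t ^+ 2 + 2 * t ^+ 2 by rewrite W; ring.
  by field.
have := is_derive1_comp (f := @ln R) (g := fun t => 1 + 2 * t / cochord t)
  (is_derive1_ln p0) d1.
move=> /is_derive_eq; apply; rewrite /slope_den -sqr_cochord//.
by field; rewrite !gt_eqF//; lra.
Qed.

Lemma is_derive_tangent_intercept t : 0 <= t < 2 ->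
  is_derive t 1 tangent_intercept
    (8 * t * slope_den' t / slope_den t ^+ 2).
Proof.
move=> t02; have qn0 : slope_den t != 0 by rewrite gt_eqF// slope_den_gt0.
have d0 := is_derive_quot qn0 (is_derive_scale 8 t) (is_derive_slope_den t02).
have := is_deriveB (f := logbound) (is_derive_logbound t02) d0.
by move=> /is_derive_eq; apply; field.
Qed.

(** The derivative of [slope_den] changes sign at most once, from plus to minus:
    it is decreasing as long as [t ^+ 2 <= 4 / 3], because [t * cochord t] grows
    there, and it is negative beyond. *)
Lemma slope_den'_gt0_left a t : 0 < a -> a < t < 2 ->
  0 <= slope_den' t -> 0 < slope_den' a.
Proof.
move=> a0 at2.
have wa : 0 < cochord a by apply: cochord_gt0; lra.
have wt : 0 < cochord t by apply: cochord_gt0; lra.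
have Wa : cochord a ^+ 2 = 4 - a ^+ 2 by apply: sqr_cochord; lra.
have Wt : cochord t ^+ 2 = 4 - t ^+ 2 by apply: sqr_cochord; lra.
rewrite /slope_den' => H.
have t2 : t ^+ 2 <= 4 / 3 by nra.
suff : a * cochord a < t * cochord t by nra.
rewrite -(ltr_pXn2r (n := 2)) ?nnegrE ?mulr_ge0 ?ltW//; last by lra.
rewrite !exprMn Wa Wt.
have : a ^+ 2 < t ^+ 2 by nra.
nra.
Qed.

(** The tangent intercept vanishes at 0 and increases as long as [slope_den']
    stays positive. *)
Lemma tangent_intercept_gt0 t : 0 < t < 2 -> 0 <= slope_den' t ->
  0 < tangent_intercept t.
Proof.
move=> t02 dt; have h0 : tangent_intercept 0 = 0.
  by rewrite /tangent_intercept /logbound !mulr0 !mul0r addr0 ln1 subr0.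
rewrite -h0.
apply: (derive_gt0_lt (df := fun t => 8 * t * slope_den' t / slope_den t ^+ 2)).
- lra.
- by move=> s s0; apply: is_derive_tangent_intercept; lra.
move=> s s0; have ds : 0 < slope_den' s.
  by apply: (@slope_den'_gt0_left _ t) => //; lra.
have qs : 0 < slope_den s by apply: slope_den_gt0; lra.
by rewrite divr_gt0 ?exprn_gt0// pmulr_rgt0//; lra.
Qed.

(** Once [slope_den'] is negative it stays so, hence the tangent intercept
    decreases from there on. *)
Lemma tangent_intercept_decr a t : 0 < a -> a < t < 2 -> slope_den' a < 0 ->
  tangent_intercept t < tangent_intercept a.
Proof.
move=> a0 at2 da; rewrite -ltrN2.
apply: (derive_gt0_lt (f := fun t => - tangent_intercept t)
  (df := fun t => - (8 * t * slope_den' t / slope_den t ^+ 2))).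
- lra.
- by move=> s s0; apply: is_deriveN; apply: is_derive_tangent_intercept; lra.
move=> s s0; have qs : 0 < slope_den s by apply: slope_den_gt0; lra.
have ds : slope_den' s < 0.
  rewrite ltNge; apply/negP => /(slope_den'_gt0_left a0); lra.
by rewrite -mulNr -mulrN divr_gt0 ?exprn_gt0// pmulr_rgt0//; lra.
Qed.

Lemma cochord_le a b : 0 <= b -> 4 - a ^+ 2 <= b ^+ 2 -> cochord a <= b.
Proof. by move=> b0 ab; rewrite -(ger0_norm b0) -sqrtr_sqr ler_wsqrtr. Qed.

Lemma cochord_ge a b : 0 <= b -> b ^+ 2 <= 4 - a ^+ 2 -> b <= cochord a.
Proof. by move=> b0 ab; rewrite -(ger0_norm b0) -sqrtr_sqr ler_wsqrtr. Qed.

(** With [logbound_233_200_le], this locates [t0] between 231/200 and 233/200,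
    the interval of half-width 1/200 around 1.16, and brackets the minimal slope
    between (22/25) / (233/200) and (89/100) / (233/200). The true values of
    [logbound] at the two points are about 0.8816 and 0.8892. *)
Lemma logbound_231_200_ge : 22 / 25 <= logbound (231 / 200).
Proof.
have t02 : 0 <= (231 / 200 : R) < 2 by lra.
have w0 := cochord_gt0 t02; have p0 := logbound_arg_gt0 t02.
have wb : cochord (231 / 200) <= 49 / 30 by apply: cochord_le; lra.
have s01 : 0 < (41 / 99 : R) < 1 by lra.
(* 70 / 29 = 2.4137... is slightly below the argument 2.4147... of the
   logarithm at 231 / 200. *)
have e : (1 + 41 / 99) / (1 - 41 / 99) = 70 / 29 :> R by field.
have e0 : 0 < 70 / 29 :> R by lra.
apply: (@le_trans _ _ (ln (70 / 29))).
  by rewrite -e; apply: le_trans (ln_ge_atanh s01); lra.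
rewrite /logbound ler_ln ?posrE; [|exact: e0|exact: p0].
by rewrite -lerBlDl ler_pdivlMr; [lra|exact: w0].
Qed.

Lemma logbound_233_200_le : logbound (233 / 200) <= 89 / 100.
Proof.
have t02 : 0 <= (233 / 200 : R) < 2 by lra.
have w0 := cochord_gt0 t02; have p0 := logbound_arg_gt0 t02.
have wb : 13 / 8 <= cochord (233 / 200) by apply: cochord_ge; lra.
have x0 : 0 <= (89 / 100 : R) by lra.
rewrite -[leRHS]expRK /logbound ler_ln ?posrE; [|exact: p0|exact: expR_gt0].
(* The argument of the logarithm is about 2.4333, below both 2.434 and the six
   first terms of the series of exp (0.89), about 2.4343. *)
apply: le_trans (expR_ge_series 6 x0).
apply: (@le_trans _ _ (1217 / 500)).
  by rewrite -lerBrDl ler_pdivrMr; [lra|exact: w0].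
rewrite /series /exp_coeff /= !big_nat_recr; try exact: leq0n.
rewrite big_nil /= !factS fact0.
lra.
Qed.

Lemma tangent_intercept_231_200_gt0 : 0 < tangent_intercept (231 / 200).
Proof.
have q0 : 0 < slope_den (231 / 200) by apply: slope_den_gt0; lra.
have wb : 163 / 100 <= cochord (231 / 200) by apply: cochord_ge; lra.
apply: lt_le_trans (lerB logbound_231_200_ge (lexx _)).
by rewrite subr_gt0 ltr_pdivrMr /slope_den; [lra|exact: q0].
Qed.

Lemma tangent_intercept_233_200_lt0 : tangent_intercept (233 / 200) < 0.
Proof.
have q0 : 0 < slope_den (233 / 200) by apply: slope_den_gt0; lra.
have wb : cochord (233 / 200) <= 163 / 100 by apply: cochord_le; lra.
apply: le_lt_trans (lerB logbound_233_200_le (lexx _)) _.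
by rewrite subr_lt0 ltr_pdivlMr /slope_den; [lra|exact: q0].
Qed.

Lemma tangent_intercept_root :
  exists2 t0, 231 / 200 <= t0 <= 233 / 200 & tangent_intercept t0 = 0.
Proof.
have hl := tangent_intercept_231_200_gt0.
have hr := tangent_intercept_233_200_lt0.
have [|||t0] := @IVT R tangent_intercept (231 / 200) (233 / 200) 0.
- lra.
- apply: derivable_within_continuous => t; rewrite in_itv /= => t0.
  have t02 : 0 <= t < 2 by lra.
  by case: (is_derive_tangent_intercept t02).
- by rewrite ge_min le_max (ltW hl) (ltW hr) orbT.
by rewrite in_itv => t0I h0; exists t0.
Qed.

(** Before [t0], either the intercept is still in its positive increasing phase,
    or it is already decreasing towards its value 0 at [t0]; the latter is the
    case at [t0] itself, whence the sign after [t0]. *)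
Lemma tangent_intercept_sign t0 t :
  0 < t0 < 2 -> tangent_intercept t0 = 0 -> 0 < t < 2 ->
  (t < t0 -> 0 < tangent_intercept t) /\ (t0 < t -> tangent_intercept t < 0).
Proof.
move=> t02 h0 t2; split=> tt.
  have [dt|dt] := leP 0 (slope_den' t); first exact: tangent_intercept_gt0.
  by rewrite -h0; apply: tangent_intercept_decr => //; lra.
have dt0 : slope_den' t0 < 0.
  by rewrite ltNge; apply/negP => /(tangent_intercept_gt0 t02); rewrite h0 ltxx.
by rewrite -h0; apply: tangent_intercept_decr => //; lra.
Qed.

Lemma is_derive_logbound_slope t : 0 < t < 2 ->
  is_derive t 1 (fun t => logbound t / t) (- tangent_intercept t / t ^+ 2).
Proof.
move=> t02; have t02' : 0 <= t < 2 by lra.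
have tn0 : t != 0 by rewrite gt_eqF//; lra.
have := is_derive_quot (g := id) tn0 (is_derive_logbound t02')
  (is_derive_id t (1 : R)).
move=> /is_derive_eq; apply; rewrite /tangent_intercept /=.
by field; rewrite tn0 gt_eqF ?slope_den_gt0.
Qed.

Lemma logbound_slope_min t0 t :
  0 < t0 < 2 -> tangent_intercept t0 = 0 -> 0 < t < 2 ->
  logbound t0 / t0 <= logbound t / t.
Proof.
move=> t02 h0 t2; have [tt|tt|->//] := ltgtP t t0; apply: ltW.
  rewrite -ltrN2.
  apply: (derive_gt0_lt (f := fun t => - (logbound t / t))
    (df := fun t => - (- tangent_intercept t / t ^+ 2))) => // s st.
    by apply: is_deriveN; apply: is_derive_logbound_slope; lra.
  have s2 : 0 < s < 2 by lra.
  have [hs _] := tangent_intercept_sign t02 h0 s2.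
  by rewrite mulNr opprK divr_gt0 ?exprn_gt0 ?hs//; lra.
apply: (derive_gt0_lt (f := fun t => logbound t / t)
  (df := fun t => - tangent_intercept t / t ^+ 2)) => // s st.
  by apply: is_derive_logbound_slope; lra.
have s2 : 0 < s < 2 by lra.
have [_ hs] := tangent_intercept_sign t02 h0 s2.
by rewrite divr_gt0 ?exprn_gt0 ?oppr_gt0 ?hs//; lra.
Qed.

Lemma logbound_incr a b : 0 <= a -> a < b < 2 -> logbound a < logbound b.
Proof.
move=> a0 ab; apply: (derive_gt0_lt (df := fun t => 8 / slope_den t)); first lra.
  by move=> t tab; apply: is_derive_logbound; lra.
by move=> t tab; rewrite divr_gt0// slope_den_gt0//; lra.
Qed.

End LogBound.

(** * The Euclidean norm *)

Section EuclideanNorm.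
Variables (R : realType) (n : nat).
Implicit Types (x y u v p : 'rV[R]_n) (D : set 'rV[R]_n) (d r rho : R).

Definition edot u v : R := \sum_(i < n) u 0 i * v 0 i.

Lemma edotDl u v w : edot (u + v) w = edot u w + edot v w.
Proof. by rewrite -big_split; apply: eq_bigr => i _; rewrite mxE mulrDl. Qed.

Lemma edotC u v : edot u v = edot v u.
Proof. by apply: eq_bigr => i _; rewrite mulrC. Qed.

Lemma edotDr u v w : edot w (u + v) = edot w u + edot w v.
Proof. by rewrite !(edotC w) edotDl. Qed.

Lemma edotZl a u v : edot (a *: u) v = a * edot u v.
Proof. by rewrite /edot mulr_sumr; apply: eq_bigr => i _; rewrite mxE mulrA. Qed.

Lemma edotZr a u v : edot u (a *: v) = a * edot u v.
Proof. by rewrite edotC edotZl edotC. Qed.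

Definition edotE := (edotDl, edotDr, edotZl, edotZr).

Lemma edot_ge0 u : 0 <= edot u u.
Proof. by apply: sumr_ge0 => i _; rewrite -expr2 sqr_ge0. Qed.

Lemma enorm_ge0 u : 0 <= enorm u.
Proof. exact: sqrtr_ge0. Qed.

Lemma sqr_enorm u : enorm u ^+ 2 = edot u u.
Proof.
rewrite /enorm sqr_sqrtr; last by apply: sumr_ge0 => i _; rewrite sqr_ge0.
by apply: eq_bigr => i _; rewrite expr2.
Qed.

Lemma enormZ a u : enorm (a *: u) = `|a| * enorm u.
Proof.
apply/(pexpIrn (n := 2)) => //.
- by rewrite nnegrE enorm_ge0.
- by rewrite nnegrE mulr_ge0 ?enorm_ge0.
- by rewrite exprMn !sqr_enorm !edotE real_normK ?num_real// mulrA expr2.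
Qed.

Lemma enormB u v : enorm (u - v) = enorm (v - u).
Proof. by rewrite -opprB -scaleN1r enormZ normrN1 mul1r. Qed.

Lemma le_coord_enorm u i : `|u 0 i| <= enorm u.
Proof.
rewrite -sqrtr_sqr ler_sqrt; last by apply: sumr_ge0 => j _; rewrite sqr_ge0.
by rewrite (bigD1 i)//= lerDl sumr_ge0// => j _; rewrite sqr_ge0.
Qed.

Lemma enorm_gt0 u : u != 0 -> 0 < enorm u.
Proof.
move=> un0; rewrite lt0r enorm_ge0 andbT; apply: contra un0 => /eqP u0.
apply/eqP/rowP => i; rewrite mxE; apply/normr0_eq0/le_anti.
by rewrite normr_ge0 -u0 le_coord_enorm.
Qed.

Lemma edot_CauchySchwarz u v : edot u v ^+ 2 <= edot u u * edot v v.
Proof.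
have [v0|v0] := eqVneq v 0.
  by rewrite v0 -(scale0r v) !edotE !mul0r mulr0 expr0n.
have vv : 0 < edot v v by rewrite -sqr_enorm exprn_gt0// enorm_gt0.
(* This vector is the part of u orthogonal to v, cleared of its denominator. *)
have := edot_ge0 (edot v v *: u + (- edot u v) *: v).
rewrite !edotE (edotC v u) => H.
by rewrite -subr_ge0 -(pmulr_rge0 _ vv); apply: le_trans H _; lra.
Qed.

Lemma parallelogram u v :
  enorm (u - v) ^+ 2 + enorm (u + v) ^+ 2 = 2 * (enorm u ^+ 2 + enorm v ^+ 2).
Proof. by rewrite -(scaleN1r v) !sqr_enorm !edotE (edotC v u); ring. Qed.

(** The squared product of the distances from v to u and to -u is
    (|u|^2 + |v|^2)^2 - 4 (u . v)^2; by Cauchy-Schwarz it is at least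
    (|v|^2 - |u|^2)^2, with equality on the line through u and -u. *)
Lemma le_prod_dist_antipodal u v :
  enorm v ^+ 2 - enorm u ^+ 2 <= enorm (u - v) * enorm (v + u).
Proof.
have [le0|/ltW ge0] := leP (enorm v ^+ 2 - enorm u ^+ 2) 0.
  by rewrite (le_trans le0)// mulr_ge0 ?enorm_ge0.
rewrite -(ler_pXn2r (n := 2)) ?nnegrE ?mulr_ge0 ?enorm_ge0//.
have := edot_CauchySchwarz u v.
rewrite exprMn -(scaleN1r v) !sqr_enorm !edotE (edotC v u).
nra.
Qed.

Lemma continuous_enorm : continuous (@enorm R n).
Proof.
move=> x; apply: (continuous_comp (f := fun u => \sum_(i < n) u 0 i ^+ 2)).
  apply: continuous_big => [|i _ {}x]; first exact: add_continuous.
  apply: (@continuous_comp _ _ _ (fun u : 'rV[R]_n => u 0 i)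
    (fun a : R => a ^+ 2)); first exact: coord_continuous.
  exact: exprn_continuous.
exact: sqrt_continuous.
Qed.

Lemma open_eball z r : open (@eball R n z r).
Proof.
have c : continuous (fun x => enorm (x - z)).
  move=> x; apply: (continuous_comp (f := fun x => x - z)); last first.
    exact: continuous_enorm.
  have : continuous (fun u : 'rV[R]_n => u - z).
    move=> u; apply: continuousB; [exact: cvg_id|exact: cst_continuous].
  exact.
by move/continuousP: c => c; exact: (c [set t | t < r] (@open_lt _ r)).
Qed.

(** Bounds the quotients in the Cassinian supremum: an open set contains a
    sup-norm ball around each of its points, and the Euclidean norm dominates
    the sup norm. *)
Lemma enorm_dist_setC D x : open D -> D x ->
  exists2 d : R, 0 < d & forall p, ~ D p -> d <= enorm (x - p).
Proof.
move=> oD Dx; have /nbhs_ballP[d /= d0 dD] := open_nbhs_nbhs (conj oD Dx).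
exists d => // p nDp; rewrite leNgt; apply/negP => pd; apply/nDp/dD.
split=> // i j; rewrite [i]ord1 /ball /=.
by have := le_coord_enorm (x - p) j; rewrite !mxE => /le_lt_trans; apply.
Qed.

(** * Bounds of the Cassinian metric *)

(** The last point of a ray in D, when the ray leaves D for good, is a boundary
    point: it is a limit of points of D, and D being open it is not in D. *)
Lemma exit_point D y v : open D -> D y ->
  has_ubound [set t : R | D (y + t *: v)] ->
  let s := sup [set t : R | D (y + t *: v)] in
  boundary D (y + s *: v) /\ forall t, D (y + t *: v) -> t < s.
Proof.
move=> oD Dy ub; set T := [set t | _] in ub *; move=> s.
have T0 : T !=set0 by exists 0; rewrite /T /= scale0r addr0.
have c : continuous (fun t : R => y + t *: v).
  move=> t; apply: cvgD; first exact: cvg_cst.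
  by apply: cvgZl; exact: cvg_id.
have oT : open T by have /continuousP/(_ _ oD) := c.
have nTs : ~ T s.
  move=> Ts; have /nbhs_ballP[d /= d0 dT] := open_nbhs_nbhs (conj oT Ts).
  have : T (s + d / 2).
    by apply: dT; rewrite /ball /= opprD addNKr normrN gtr0_norm; lra.
  by move=> /(ub_le_sup ub); rewrite -/s; lra.
split; last first.
  move=> t Tt; rewrite lt_neqAle ub_le_sup// andbT.
  by apply/eqP => ts; apply: nTs; rewrite -ts.
split; last by rewrite ((interior_id D).1 oD).
move=> B nB; have [t [Tt Bt]] := closure_sup T0 ub (c s B nB).
by exists (y + t *: v).
Qed.

(** Let p and q be the extreme points of closure D on the line through x and y,
    beyond x and beyond y. Then |p - q| <= d, since p - q is a limit of
    differences of points of D, so one of the two, say p, is at distance at most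
    d / 2 from the midpoint of x and y. On the line, the product of the distances
    from p to x and y is the square of this distance minus (|x - y| / 2)^2. *)
Lemma chord_boundary_point D d x y : open D ->
  (forall a b, D a -> D b -> enorm (a - b) <= d) -> D x -> D y -> x != y ->
  exists2 p, boundary D p & 0 < enorm (x - p) * enorm (p - y) /\
    4 * (enorm (x - p) * enorm (p - y)) <= d ^+ 2 - enorm (x - y) ^+ 2.
Proof.
move=> oD diamD Dx Dy xy; set v := x - y.
have v0 : 0 < enorm v by rewrite enorm_gt0// subr_eq0.
pose s := sup [set t : R | D (x + t *: v)].
pose s' := sup [set t : R | D (y + t *: - v)].
have chord t t' : D (x + t *: v) -> D (y + t' *: - v) ->
    t + t' <= d / enorm v - 1.
  move=> Dt Dt'; rewrite lerBrDr ler_pdivlMr//.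
  apply: le_trans (diamD _ _ Dt Dt').
  have -> : x + t *: v - (y + t' *: - v) = (t + t' + 1) *: v.
    by apply/rowP => i; rewrite !mxE; ring.
  by rewrite enormZ ler_wpM2r ?ler_norm// enorm_ge0.
have Dx0 : D (x + 0 *: v) by rewrite scale0r addr0.
have Dy0 : D (y + 0 *: - v) by rewrite scale0r addr0.
have [bs s_gt] : boundary D (x + s *: v) /\ forall t, D (x + t *: v) -> t < s.
  apply: exit_point => //; exists (d / enorm v - 1) => t /= Dt.
  by have := chord _ _ Dt Dy0; rewrite addr0.
have [bs' s'_gt] : boundary D (y + s' *: - v) /\
    forall t, D (y + t *: - v) -> t < s'.
  apply: exit_point => //; exists (d / enorm v - 1) => t /= Dt.
  by have := chord _ _ Dx0 Dt; rewrite add0r.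
have s0 := s_gt _ Dx0; have s'0 := s'_gt _ Dy0.
have ss' : (s + s' + 1) * enorm v <= d.
  rewrite -ler_pdivlMr// -lerBrDr -lerBrDl.
  apply: ge_sup; first by exists 0.
  move=> t' /= Dt'; rewrite lerBrDl -lerBrDr.
  apply: ge_sup; first by exists 0.
  by move=> t /= Dt; rewrite lerBrDr; exact: chord.
(* Here k is the smaller of s and s', and k + 1/2 is the distance from the exit
   point to the midpoint, in units of |v|. *)
have prod k : 0 < k -> 2 * k <= s + s' ->
    0 < k * enorm v * ((1 + k) * enorm v) /\
    4 * (k * enorm v * ((1 + k) * enorm v)) <= d ^+ 2 - enorm v ^+ 2.
  move=> k0 k2; split; first by rewrite !mulr_gt0//; lra.
  have : (2 * k + 1) * enorm v <= d.
    by apply: le_trans ss'; rewrite ler_pM2r//; lra.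
  have : 0 <= (2 * k + 1) * enorm v by rewrite mulr_ge0//; lra.
  nra.
have [le_s|le_s] := leP s s'.
- exists (x + s *: v) => //.
  have -> : x - (x + s *: v) = (- s) *: v by apply/rowP => i; rewrite !mxE; ring.
  have -> : x + s *: v - y = (1 + s) *: v by apply/rowP => i; rewrite !mxE; ring.
  rewrite !enormZ normrN !gtr0_norm//; last lra.
  by apply: prod => //; lra.
- exists (y + s' *: - v) => //.
  have -> : x - (y + s' *: - v) = (1 + s') *: v.
    by apply/rowP => i; rewrite !mxE; ring.
  have -> : y + s' *: - v - y = (- s') *: v.
    by apply/rowP => i; rewrite !mxE; ring.
  rewrite !enormZ normrN !gtr0_norm//; last lra.
  rewrite (mulrC ((1 + s') * _)).
  by apply: prod => //; lra.
Qed.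

(** A single boundary point bounds the supremum from below as soon as the set of
    quotients is bounded above. *)
Lemma cassinian_ge D r x y : open D ->
  (forall a b, D a -> D b -> enorm (a - b) <= 2 * r) -> D x -> D y -> x != y ->
  ln (1 + 2 * enorm (x - y) / Num.sqrt (4 * r ^+ 2 - enorm (x - y) ^+ 2))
    <= cassinian D x y.
Proof.
move=> oD diamD Dx Dy xy.
have [p bp [p0 pd]] := chord_boundary_point oD diamD Dx Dy xy.
have v0 : 0 < enorm (x - y) by rewrite enorm_gt0// subr_eq0.
have [dx dx0 Dxd] := enorm_dist_setC oD Dx.
have [dy dy0 Dyd] := enorm_dist_setC oD Dy.
have S_ub : has_ubound
    [set enorm (x - y) / Num.sqrt (enorm (x - p) * enorm (p - y))
    | p in boundary D].
  exists (enorm (x - y) / Num.sqrt (dx * dy)) => _ [b [_ Db] <-].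
  rewrite ((interior_id D).1 oD) in Db.
  have xb := Dxd _ Db; have yb := Dyd _ Db; rewrite enormB in yb.
  have xyb : dx * dy <= enorm (x - b) * enorm (b - y).
    by apply: ler_pM => //; exact: ltW.
  have xy0 : 0 < dx * dy by rewrite mulr_gt0.
  rewrite ler_pM2l// lef_pV2 ?posrE ?sqrtr_gt0 ?(lt_le_trans xy0)//.
  by rewrite ler_sqrt// (le_trans (ltW xy0)).
set a := 2 * _ / _.
have a_le : a <= enorm (x - y) / Num.sqrt (enorm (x - p) * enorm (p - y)).
  rewrite /a (mulrC 2) -mulrA ler_pM2l//.
  rewrite -(@ler_pM2l _ 2^-1)// mulKf// -invfM.
  set P : R := enorm (x - p) * _ in p0 pd *.
  have -> : 2 * Num.sqrt P = Num.sqrt (4 * P).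
    have -> : 4 * P = 2 ^+ 2 * P by ring.
    by rewrite [RHS]sqrtrM ?sqr_ge0// sqrtr_sqr ger0_norm.
  rewrite exprMn in pd.
  have -> : 4 * r ^+ 2 = 2 ^+ 2 * r ^+ 2 by ring.
  have p4 : 0 < 4 * P by rewrite mulr_gt0.
  rewrite lef_pV2 ?posrE ?sqrtr_gt0// ?(lt_le_trans p4)//.
  by rewrite ler_sqrt// (le_trans (ltW p4)).
have a0 : 0 <= a by rewrite divr_ge0 ?mulr_ge0 ?sqrtr_ge0// ltW.
have a_sup : a <= sup
    [set enorm (x - y) / Num.sqrt (enorm (x - p) * enorm (p - y))
    | p in boundary D].
  by apply: le_trans a_le _; apply: ub_le_sup => //; exists p.
by rewrite /cassinian ler_ln ?posrE ?lerD2l//; lra.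
Qed.

(** In coordinates centred at the midpoint z, the points x and y are opposite, so
    [le_prod_dist_antipodal] bounds every denominator in the supremum. *)
Lemma cassinian_eball_le z rho x y :
  eball z rho x -> x != y -> z = 2^-1 *: (x + y) ->
  cassinian (eball z rho) x y <=
    ln (1 + 2 * enorm (x - y) /
              Num.sqrt (4 * rho ^+ 2 - enorm (x - y) ^+ 2)).
Proof.
move=> xz xy zE; set v := x - y.
have v0 : 0 < enorm v by rewrite enorm_gt0// subr_eq0.
pose u := 2^-1 *: v.
have uE : enorm v = 2 * enorm u by rewrite enormZ ger0_norm// mulVKf.
have xzE : x = z + u by apply/rowP => i; rewrite zE !mxE; field.
have yzE : y = z - u by apply/rowP => i; rewrite zE !mxE; field.
have u_lt : enorm u < rho by move: xz; rewrite /eball /= xzE addrC addKr.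
have u0 := enorm_ge0 u; have rho0 := le_lt_trans u0 u_lt.
have prod p : ~ eball z rho p ->
    rho ^+ 2 - enorm u ^+ 2 <= enorm (x - p) * enorm (p - y).
  move=> /negP; rewrite /eball /= -leNgt => pz.
  have -> : x - p = u - (p - z) by apply/rowP => i; rewrite xzE !mxE; ring.
  have -> : p - y = p - z + u by apply/rowP => i; rewrite yzE !mxE; ring.
  apply: le_trans (le_prod_dist_antipodal _ _).
  by rewrite lerD2r ler_pXn2r ?nnegrE ?enorm_ge0// ltW.
have den0 : 0 < rho ^+ 2 - enorm u ^+ 2 by nra.
rewrite /cassinian; set S := image _ _.
set a := 2 * _ / _.
have aE : a = enorm v / Num.sqrt (rho ^+ 2 - enorm u ^+ 2).
  rewrite /a uE.
  have -> : 4 * rho ^+ 2 - (2 * enorm u) ^+ 2 =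
    2 ^+ 2 * (rho ^+ 2 - enorm u ^+ 2) by ring.
  rewrite sqrtrM ?sqr_ge0// sqrtr_sqr ger0_norm//; field.
  by rewrite gt_eqF// sqrtr_gt0.
have a0 : 0 <= a by rewrite aE divr_ge0 ?sqrtr_ge0// ltW.
have S_le : forall b, S b -> b <= a.
  move=> _ [p [_ pz] <-]; rewrite aE.
  have oB : open (eball z rho) by exact: open_eball.
  rewrite ((interior_id (eball z rho)).1 oB) in pz.
  have := prod p pz => pp.
  rewrite ler_pM2l// lef_pV2 ?posrE ?sqrtr_gt0 ?(lt_le_trans den0)//.
  by rewrite ler_sqrt// (le_trans (ltW den0)).
(* An empty set of quotients has supremum 0 by convention. *)
have sup_le : sup S <= a.
  have [->|/set0P S0] := eqVneq S set0; first by rewrite sup0.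
  exact: ge_sup.
have sup_ge0 : 0 <= sup S.
  have [->|/set0P[b Sb]] := eqVneq S set0; first by rewrite sup0.
  have [p _ pb] := Sb.
  apply: le_trans (ub_le_sup _ Sb); last by exists a.
  by rewrite -pb divr_ge0 ?sqrtr_ge0// enorm_ge0.
by rewrite ler_ln ?posrE ?lerD2l//; lra.
Qed.

(** A form of the triangle inequality, read off the parallelogram identity. *)
Lemma eball_dist_le z rho (a b : 'rV[R]_n) : eball z rho a -> eball z rho b ->
  enorm (a - b) <= 2 * rho.
Proof.
rewrite /eball /= => az bz.
have [a0 b0] := (enorm_ge0 (a - z), enorm_ge0 (b - z)).
rewrite -(ler_pXn2r (n := 2)) ?nnegrE ?enorm_ge0//; last by lra.
have -> : a - b = (a - z) - (b - z) by apply/rowP => i; rewrite !mxE; ring.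
have := parallelogram (a - z) (b - z).
have := sqr_ge0 (enorm (a - z + (b - z))).
nra.
Qed.

Lemma enorm_dist_le_diam D (a b : 'rV[R]_n) :
  (ediam D < +oo)%E -> D a -> D b ->
  enorm (a - b) <= fine (ediam D).
Proof.
move=> fD Da Db.
have le_diam : ((enorm (a - b))%:E <= ediam D)%E.
  by apply: ereal_sup_ubound; exists a, b.
rewrite -lee_fin fineK// fin_numElt fD andbT.
by apply: lt_le_trans le_diam; rewrite ltNyr.
Qed.

End EuclideanNorm.

(** * The theorem *)

(* The decimals 1.16 and 0.76 are read as values rounded to two places.  The
   equality clause is stated for balls of any radius rho: for 2 <= n, no ball
   has radius sqrt (n / (2 n + 2)) times its diameter. *)
Theorem theorem3p3 (R : realType) :
  exists t0 : R,
    unique (fun t : R => 0 < t < 2 /\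
      (4 - t ^+ 2) * (2 * t + Num.sqrt (4 - t ^+ 2)) *
        ln (1 + 2 * t / Num.sqrt (4 - t ^+ 2)) - 8 * t = 0) t0 /\
    `|t0 - 116 / 100| <= 5 / 1000 /\
    let c := t0^-1 * ln (1 + 2 * t0 / Num.sqrt (4 - t0 ^+ 2)) in
    is_minimum [set t^-1 * ln (1 + 2 * t / Num.sqrt (4 - t ^+ 2))
               | t in [set t : R | 0 < t < 2]] c /\
    `|c - 76 / 100| <= 5 / 1000 /\
    forall n : nat, (0 < n)%N ->
      (forall D : set 'rV[R]_n,
         domain D -> D `<` setT -> (ediam D < +oo)%E ->
         let r := Num.sqrt (n%:R / (2 * n%:R + 2)) * fine (ediam D) in
         forall x y : 'rV[R]_n, D x -> D y -> x != y ->
           cassinian D x y >=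
             ln (1 + 2 * enorm (x - y) /
                       Num.sqrt (4 * r ^+ 2 - enorm (x - y) ^+ 2)) /\
           ln (1 + 2 * enorm (x - y) /
                     Num.sqrt (4 * r ^+ 2 - enorm (x - y) ^+ 2)) >=
             c * (enorm (x - y) / r)) /\
      (forall (z : 'rV[R]_n) (rho : R), 0 < rho ->
         forall x y : 'rV[R]_n, eball z rho x -> eball z rho y -> x != y ->
           z = 2^-1 *: (x + y) ->
           cassinian (eball z rho) x y =
             ln (1 + 2 * enorm (x - y) /
                       Num.sqrt (4 * rho ^+ 2 - enorm (x - y) ^+ 2))).
Proof.
have [t0 t0b h0] := tangent_intercept_root R.
have t02 : 0 < t0 < 2 by lra.
have zeroE (t : R) : 0 < t < 2 ->
    ((4 - t ^+ 2) * (2 * t + Num.sqrt (4 - t ^+ 2)) *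
      ln (1 + 2 * t / Num.sqrt (4 - t ^+ 2)) - 8 * t = 0) <->
    tangent_intercept t = 0.
  move=> t2; have q0 : 0 < slope_den t by apply: slope_den_gt0; lra.
  have E : slope_den t * logbound t - 8 * t =
      slope_den t * tangent_intercept t.
    by rewrite /tangent_intercept; field; rewrite gt_eqF.
  rewrite -/(cochord t) -/(slope_den t) -/(logbound t) E.
  split=> [/eqP|->]; last by rewrite mulr0.
  by rewrite mulf_eq0 gt_eqF//= => /eqP.
exists t0; split.
  split=> [|t [t2 /(zeroE t t2) ht]]; first by split=> //; apply/zeroE.
  have [tl tr] := tangent_intercept_sign t02 h0 t2.
  have [tt|tt|//] := ltgtP t0 t.
    by have := tr tt; rewrite ht ltxx.
  by have := tl tt; rewrite ht ltxx.
split; first by rewrite ler_norml; lra.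
rewrite -/(cochord t0) -/(logbound t0) => c.
have cE : c = logbound t0 / t0 by rewrite /c mulrC.
have c_le (t : R) : 0 < t < 2 -> c <= logbound t / t.
  by move=> t2; rewrite cE; exact: logbound_slope_min.
split.
  split; first by exists t0.
  by move=> _ [t t2 <-]; rewrite mulrC; exact: c_le.
split.
  have cl : 22 / 25 <= c * t0.
    rewrite cE divfK ?gt_eqF//; last by lra.
    apply: le_trans (logbound_231_200_ge R) _.
    have [->//|tn] := eqVneq (231 / 200) t0.
    by apply/ltW/logbound_incr; [lra|rewrite lt_neqAle tn; lra].
  have cr : c * (233 / 200) <= 89 / 100.
    apply: le_trans (logbound_233_200_le R); rewrite -ler_pdivlMr; last by lra.
    by apply: c_le; lra.
  have c0 : 0 <= c by nra.
  have cl' : 22 / 25 <= c * (233 / 200).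
    by apply: le_trans cl _; apply: ler_wpM2l => //; lra.
  by rewrite ler_norml; lra.
move=> n n0; split=> [D [_ oD _] _ fD r x y Dx Dy xy|z rho rho0 x y xz yz xy zE].
  have d0 : 0 < enorm (x - y) by rewrite enorm_gt0// subr_eq0.
  have diamD a b : D a -> D b -> enorm (a - b) <= 2 * r.
    move=> Da Db; apply: le_trans (enorm_dist_le_diam fD Da Db) _.
    have diam0 : 0 <= fine (ediam D).
      by apply: le_trans (enorm_dist_le_diam fD Da Db); exact: enorm_ge0.
    (* For 1 <= n, n / (2 n + 2) is at least 1 / 4, so diam D <= 2 r. *)
    rewrite mulrA ler_peMl//.
    have n1 : 1 <= n%:R :> R by rewrite ler1n.
    rewrite -ler_pdivrMl// mulr1 -[leLHS]ger0_norm// -sqrtr_sqr ler_wsqrtr//.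
    by rewrite ler_pdivlMr; lra.
  split; first exact: cassinian_ge.
  have r0 : 0 < r by have := diamD _ _ Dx Dy; lra.
  have [p _ [p0 pd]] := chord_boundary_point oD diamD Dx Dy xy.
  set d := enorm (x - y) in d0 pd *.
  (* Strictly: the exit points of the line lie outside the segment [x, y]. *)
  have dr : d < 2 * r.
    have d2 : d ^+ 2 < (2 * r) ^+ 2.
      by rewrite -subr_gt0; apply: lt_le_trans pd; rewrite pmulr_rgt0.
    rewrite -(ltr_pXn2r (n := 2))// nnegrE; first exact: ltW.
    by rewrite mulr_ge0// ltW.
  have t2 : 0 < d / r < 2 by rewrite divr_gt0// ltr_pdivrMr.
  (* By homogeneity, only the ratio of |x - y| to r matters. *)
  have -> : ln (1 + 2 * d / Num.sqrt (4 * r ^+ 2 - d ^+ 2)) = logbound (d / r).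
    rewrite /logbound /cochord; congr (ln (1 + _)).
    have -> : 4 * r ^+ 2 - d ^+ 2 = r ^+ 2 * (4 - (d / r) ^+ 2).
      by field; rewrite gt_eqF.
    have w0 : 0 < cochord (d / r) by apply: cochord_gt0; lra.
    rewrite sqrtrM ?sqr_ge0// sqrtr_sqr gtr0_norm// -/(cochord (d / r)).
    by field; rewrite !gt_eqF.
  by rewrite -ler_pdivlMr ?divr_gt0//; exact: c_le.
apply/le_anti/andP; split; first exact: cassinian_eball_le.
apply: cassinian_ge => //; first exact: open_eball.
exact: eball_dist_le.
Qed.
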